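(* Let $p\ge5$ be a prime, let $C\in\mathbb{F}_p$, and put $D=4-2C-\frac{C^2}{4}\in\mathbb{F}_p$. The Vieta graph of the cubic $x^2+y^2+z^2=xyz-C(x+y+z)+D$ over $\mathbb{F}_p$ satisfies the following. (a) If $C=0$: there are $p^2+1$ vertices in total, of which $6p-8$ are deficient; there are $0$ vertices of degree $2$, $6(p-2)$ vertices of degree $1$, and $4$ vertices of degree $0$. (b) If $C=8$: there are $p^2+1$ vertices in total, of which $6p-8$ are deficient; there are $3(p-2)$ vertices of degree $2$, $3(p-1)$ vertices of degree $1$, and $1$ vertex of degree $0$. (c) If $C\neq 0,8$: the total number of vertices is $p^2+1+p$ or $p^2+1-p$; there are $6p-12$ deficient vertices; there are $3(p-3)$ vertices of degree $2$, $3(p-2)$ vertices of degree $1$, and $3$ vertices of degree $0$.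
   Context: The Vieta graph of the equation $x^2+y^2+z^2=xyz-C(x+y+z)+D$ over $\mathbb{F}_p$ is the finite simple graph whose vertices are the solutions $(x,y,z)\in\mathbb{F}_p^3$, where two distinct vertices are joined by an edge whenever one is a Vieta flip of the other. The Vieta flips of $(x,y,z)$ are $(yz-C-x,y,z)$, $(x,xz-C-y,z)$, $(x,y,xy-C-z)$. Every vertex has degree at most $3$; a vertex is deficient if its degree is less than $3$. Equalities such as $C=8$ are in $\mathbb{F}_p$. *)

(* Defs.v *)
From mathcomp Require Import all_boot all_order all_algebra.

Set Implicit Arguments.
Unset Strict Implicit.
Unset Printing Implicit Defensive.

Import GRing.Theory.
Local Open Scope ring_scope.

Definition vieta_vertices (F : finFieldType) (C D : F) : {set F * F * F} :=
  [set v : F * F * F | let: (x, y, z) := v in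
     x ^+ 2 + y ^+ 2 + z ^+ 2 == x * y * z - C * (x + y + z) + D].

Definition vieta_flips (F : finFieldType) (C : F) (v : F * F * F) :
    seq (F * F * F) :=
  let: (x, y, z) := v in
  [:: (y * z - C - x, y, z); (x, x * z - C - y, z); (x, y, x * y - C - z)].

Definition vieta_edge (F : finFieldType) (C D : F) : rel (F * F * F) :=
  fun u v => [&& u \in vieta_vertices C D, v \in vieta_vertices C D, u != v
               & (v \in vieta_flips C u) || (u \in vieta_flips C v)].

Definition vieta_degree (F : finFieldType) (C D : F) (v : F * F * F) : nat :=
  #|[set w | vieta_edge C D v w]|.

Definition vieta_deficient (F : finFieldType) (C D : F) : {set F * F * F} :=
  [set v in vieta_vertices C D | (vieta_degree C D v < 3)%N].

Definition vieta_of_degree (F : finFieldType) (C D : F) (k : nat) :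
    {set F * F * F} :=
  [set v in vieta_vertices C D | vieta_degree C D v == k].

(* Main.v *)
(* Write [C = 2 h], so that [D = 4 - 4 h - h ^ 2].  As a quadratic in one variable,
   the cubic has discriminant [(x + 2) (y + 2) ((x - 2) (y - 2) - 4 h)] in the other
   two.  Hence the number of vertices is a sum of values of the quadratic character
   at this product; summing over [y] first leaves quadratics with explicit roots, and
   the total is [q ^ 2 + 1 + q chi (h (h - 4))].  A vertex is fixed by the flip of a
   coordinate iff the discriminant in that coordinate vanishes, so it lies on one of
   two lines or on a hyperbola (which degenerates to two more lines if [h = 0]).
   Each line is fixed by two flips at once, so its generic points have degree 1, the
   generic points of the hyperbolas have degree 2, and the lines meet at the points
   of degree 0. *)
Require Import Defs.
From mathcomp Require Import all_boot all_order all_algebra.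
From mathcomp Require Import ring zify.
Import GRing.Theory.
Import Order.TTheory Num.Theory.
Local Open Scope ring_scope.

(** * The quadratic character and its sums *)

(** A root count minus one, so that solution counts turn directly into character sums; in odd
    characteristic the values are 1, 0 and -1. *)
Definition quad_char {F : finFieldType} (a : F) : int :=
  #|[set w : F | w ^+ 2 == a]|%:Z - 1.

Section QuadChar.
Context {F : finFieldType}.
Hypothesis two_neq0 : (2%:R : F) != 0.
Local Notation chi := (@quad_char F).

Lemma quad_char0 : chi 0 = 0.
Proof.
rewrite /quad_char (_ : [set w | _] = [set 0]) ?cards1 //.
by apply/setP=> w; rewrite !inE expf_eq0.
Qed.

Lemma quad_char_sqr w : w != 0 -> chi (w ^+ 2) = 1.
Proof.
move=> w0; rewrite /quad_char (_ : [set v | _] = [set w; - w]).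
  rewrite cards2 -addr_eq0 -mulr2n -mulr_natr mulf_neq0 //.
by apply/setP=> v; rewrite !inE eqf_sqr.
Qed.

Lemma quad_char_nonsqr a : (forall w, w ^+ 2 != a) -> chi a = -1.
Proof.
move=> nsq; rewrite /quad_char (_ : [set w | _] = set0) ?cards0 //.
by apply/setP=> w; rewrite !inE (negPf (nsq w)).
Qed.

Lemma quad_charP a :
  (exists2 w, a = w ^+ 2 & chi a = (w != 0)%:Z) \/
  (forall w, w ^+ 2 != a) /\ chi a = -1.
Proof.
have [/existsP[w /eqP<-]|nsq] := boolP [exists w, w ^+ 2 == a].
  left; exists w => //; have [->|w0] := eqVneq w 0; first by rewrite expr0n quad_char0.
  by rewrite quad_char_sqr.
right; have {}nsq w : w ^+ 2 != a by move: nsq; rewrite negb_exists => /forallP.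
by split=> //; apply: quad_char_nonsqr.
Qed.

(** Every [w] is a square root of exactly one [a], so the root counts add up to [#|F|]. *)
Lemma sum_quad_char : \sum_a chi a = 0.
Proof.
rewrite sumrB sumr_const -mulr_natr mul1r; apply/eqP; rewrite subr_eq0; apply/eqP.
rewrite -(big_morph Posz PoszD (erefl (Posz 0))) natz; congr Posz.
rewrite -[RHS]sum1_card [RHS](partition_big (fun w : F => w ^+ 2) predT) //=.
by apply: eq_bigr => a _; rewrite -[LHS]sum1_card; apply: eq_bigl => w; rewrite inE.
Qed.

(** Multiplication by [w] carries the square roots of [a] bijectively to those of [w ^+ 2 * a]. *)
Lemma quad_charMsqr w a : w != 0 -> chi (w ^+ 2 * a) = chi a.
Proof.
move=> w0; congr (_%:Z - 1); rewrite -[RHS](card_imset _ (mulfI w0)).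
apply: eq_card => v; rewrite !inE; apply/eqP/imsetP => [vE|[u]].
  exists (v / w); last by field.
  by rewrite inE expr_div_n vE mulrAC divff ?mul1r // expf_neq0.
by rewrite inE => /eqP<- ->; rewrite exprMn.
Qed.

(* For a nonsquare [b], [chi a + chi (a * b)] is never positive and sums to 0. *)
Lemma quad_charM a b : chi (a * b) = chi a * chi b.
Proof.
have [[w -> ->]|[nsq ->]] := quad_charP b.
  have [->|w0] := eqVneq w 0; first by rewrite expr0n !mulr0 quad_char0.
  by rewrite mulrC quad_charMsqr // mulr1.
have b0 : b != 0 by have := nsq 0; rewrite expr0n eq_sym.
have le0 c : 0 <= - (chi c + chi (c * b)).
  have [[w -> ->]|[_ ->]] := quad_charP c; last first.
    have [[v _ ->]|[_ ->]] := quad_charP (c * b) => //.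
    by case: (v != 0).
  have [->|w0] := eqVneq w 0; first by rewrite expr0n mul0r quad_char0.
  by rewrite quad_charMsqr // quad_char_nonsqr.
have sum0 : \sum_c - (chi c + chi (c * b)) = 0.
  rewrite sumrN big_split /= sum_quad_char add0r.
  have shift : \sum_c chi (c * b) = 0.
    by rewrite -[RHS]sum_quad_char [RHS](reindex_inj (mulIf b0)).
  by rewrite shift oppr0.
have : - (chi a + chi (a * b)) = 0 by apply: (psumr_eq0P _ sum0) => // c _; exact: le0.
by move/eqP; rewrite oppr_eq0 addrC addr_eq0 mulrN1 => /eqP.
Qed.

Lemma sum_quad_char_affine a b : a != 0 -> \sum_z chi (a * z + b) = 0.
Proof.
move=> a0; rewrite -[RHS]sum_quad_char.
rewrite [RHS](reindex_inj (h := fun z => a * z + b)) //.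
by move=> z1 z2 /addIr /(mulfI a0).
Qed.

(* Substituting [z = b + w^-1], the product becomes [(1 + (b - a) w) / w ^ 2]. *)
Lemma sum_quad_char_roots a b : a != b -> \sum_z chi ((z - a) * (z - b)) = -1.
Proof.
move=> ab; have ba0 : b - a != 0 by rewrite subr_eq0 eq_sym.
(* Since [0^-1 = 0], the substitution permutes all of [F]. The value [w = 0] gives the root [b],
   where the product vanishes, but contributes [chi 1 = 1] to the affine sum; hence the total -1. *)
have bij : injective (fun w : F => b + w^-1) by move=> u v /addrI /invr_inj.
rewrite (reindex_inj bij) /=.
have chi1 : chi 1 = 1 by rewrite -[X in chi X](expr1n F 2) quad_char_sqr ?oner_eq0.
have := sum_quad_char_affine (b - a) 1 ba0.
rewrite (bigD1 0) //= [X in _ -> X = _](bigD1 0) //= mulr0 add0r chi1.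
rewrite invr0 addr0 subrr mulr0 quad_char0 add0r => /eqP.
rewrite addrC addr_eq0 => /eqP<-; apply: eq_bigr => w w0.
rewrite -(quad_charMsqr w) //; congr chi; field; exact: w0.
Qed.

(** * Counting the vertices *)

(** Completing the square: [z] is a root iff [2 z - b] is a square root of the discriminant. *)
Lemma card_quadratic_roots b c :
  #|[set z : F | z ^+ 2 - b * z + c == 0]|%:Z = 1 + chi (b ^+ 2 - 4%:R * c).
Proof.
rewrite addrC subrK; congr Posz.
have inj : injective (fun z => 2%:R * z - b) by move=> u v /addIr /(mulfI two_neq0).
rewrite -(card_imset _ inj); apply: eq_card => w; rewrite inE.
have sqrE z : (2%:R * z - b) ^+ 2 - (b ^+ 2 - 4%:R * c) = 2 * 2 * (z ^+ 2 - b * z + c).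
  by ring.
apply/imsetP/eqP=> [[z]|wE]; rewrite ?inE.
  by move/eqP=> zE ->; apply/eqP; rewrite -subr_eq0 sqrE zE mulr0.
have wz : w = 2%:R * ((w + b) / 2%:R) - b by field.
exists ((w + b) / 2%:R) => //; rewrite inE.
have := sqrE ((w + b) / 2%:R); rewrite -wz wE subrr => /esym/eqP.
by rewrite !mulf_eq0 (negPf two_neq0).
Qed.

Lemma card_vertices h :
  #|vieta_vertices (2%:R * h) (4%:R - 4%:R * h - h ^+ 2)|%:Z
  = (#|F| ^ 2 + 1)%N%:Z + #|F|%:Z * chi (h * (h - 4%:R)).
Proof.
set C := 2%:R * h; set D := _ - _ - _.
pose disc (x y : F) := (x + 2%:R) * (y + 2%:R) * ((x - 2%:R) * (y - 2%:R) - 4%:R * h).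
have fibers : #|vieta_vertices C D|%:Z = \sum_x \sum_y (1 + chi (disc x y)).
  rewrite pair_bigA /= -sum1_card big_mkcond /=.
  pose f (u : F * F) z := if (u, z) \in vieta_vertices C D then 1%N else 0%N.
  rewrite (eq_bigr (fun v => f v.1 v.2)) => [|[]] //.
  rewrite -(pair_bigA _ f) /=.
  rewrite (big_morph Posz PoszD (erefl (Posz 0))); apply: eq_bigr => -[x y] _ /=.
  rewrite -big_mkcond sum1dep_card.
  pose c := x ^+ 2 + y ^+ 2 + C * (x + y) - D.
  have -> : disc x y = (x * y - C) ^+ 2 - 4%:R * c by rewrite /disc /c /C /D; ring.
  rewrite -card_quadratic_roots; congr Posz; apply: eq_card => z; rewrite !inE.
  by rewrite -subr_eq0; congr (_ == 0); rewrite /c; ring.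
have inner x : \sum_y (1 + chi (disc x y)) =
    #|F|%:Z - chi ((x - 2%:R) * (x + 2%:R))
    + (if x == 2%:R - h then #|F|%:Z * chi ((x - 2%:R) * (x + 2%:R)) else 0).
  rewrite big_split /= sumr_const -mulr_natr mul1r natz -addrA; congr (_ + _).
  (* At [x = 2] the discriminant is only affine in [y], with slope [-16 h], so its character sum
     vanishes; for [h = 0] it is identically zero. *)
  have [x2|x2] := eqVneq x 2%:R.
    rewrite x2 subrr mul0r quad_char0 mulr0 if_same oppr0 add0r /disc.
    have [->|h0] := eqVneq h 0.
      by rewrite big1 // => y _; rewrite subrr mul0r mulr0 subrr mulr0 quad_char0.
    transitivity (\sum_y chi ((- (2%:R ^+ 4 * h)) * y + (- (2%:R ^+ 5 * h)))).
      by apply: eq_bigr => y _; congr chi; ring.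
    by rewrite sum_quad_char_affine // oppr_eq0 mulf_neq0 ?expf_neq0.
  have x20 : x - 2%:R != 0 by rewrite subr_eq0.
  (* The roots in [y] are [-2] and [r]. They coincide exactly for [x = 2 - h]; the product is then a
     square, summing to [#|F| - 1] instead of -1. *)
  pose r := 2%:R + 4%:R * h / (x - 2%:R).
  transitivity (chi ((x - 2%:R) * (x + 2%:R)) * \sum_y chi ((y - (- 2%:R)) * (y - r))).
    rewrite mulr_sumr; apply: eq_bigr => y _; rewrite -quad_charM; congr chi.
    by rewrite /disc /r; field.
  case: eqVneq => [xE|xh].
    have -> : r = - 2%:R.
      have h0 : - h != 0 by move: x20; rewrite xE addrAC subrr add0r.
      rewrite /r xE; field; by rewrite addrAC subrr add0r.
    rewrite (bigD1 (- 2%:R)) //= subrr mulr0 quad_char0 add0r.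
    rewrite (eq_bigr (fun=> 1)) => [|y y2]; last by rewrite -expr2 quad_char_sqr // subr_eq0.
    rewrite sumr_const cardC1 -mulr_natr mul1r natz.
    have : (0 < #|F|)%N by apply/card_gt0P; exists 0.
    case: #|F| => // n _; rewrite intS /=; ring.
  rewrite addr0 sum_quad_char_roots ?mulrN1 // eq_sym.
  apply: contra xh => /eqP rE; rewrite -subr_eq0.
  have : (r + 2%:R) * (x - 2%:R) = 4%:R * (x - (2%:R - h)) by rewrite /r; field.
  rewrite rE addrC subrr mul0r => /esym/eqP.
  by rewrite (natrM _ 2 2) !mulf_eq0 (negPf two_neq0).
rewrite fibers (eq_bigr _ (fun x _ => inner x)) big_split sumrB /=.
have n22 : 2%:R != - 2%:R :> F by rewrite -addr_eq0 -natrD (natrM _ 2 2) mulf_neq0.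
have sum1 : \sum_(x : F) chi ((x - 2%:R) * (x + 2%:R)) = -1.
  by rewrite -(sum_quad_char_roots _ _ n22); apply: eq_bigr => x _; rewrite opprK.
rewrite sum1 opprK -big_mkcond big_pred1_eq sumr_const.
rewrite -[_%:Z *+ _]mulr_natr natz PoszD -[(_ ^ 2)%N]/(_ * _)%N PoszM; congr (_ + _ * chi _); ring.
Qed.

End QuadChar.

(** * Flips, their fixed vertices, and degrees *)

(** The cubic is invariant under cyclic shifts, so statements about the first flip transfer to the
    other two. *)
Definition rot3 {T : Type} (v : T * T * T) : T * T * T :=
  let: (x, y, z) := v in (y, z, x).
Arguments rot3 {T} v : simpl never.

(* Minus the increment of the first coordinate of [v] under its flip, for [C = 2 h]. *)
Definition flip_defect {F : finFieldType} (h : F) (v : F * F * F) : F :=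
  let: (x, y, z) := v in 2%:R * x - y * z + 2%:R * h.

Definition vieta_cubic {F : finFieldType} (h : F) (v : F * F * F) : F :=
  let: (x, y, z) := v in
  x ^+ 2 + y ^+ 2 + z ^+ 2 - x * y * z + 2%:R * h * (x + y + z)
  - (4%:R - 4%:R * h - h ^+ 2).

(* [b1], [b2], [b3] tell which of the three flips move the vertex. *)
Definition flip_class {F : finFieldType} (h : F) (b1 b2 b3 : bool) :
    {set F * F * F} :=
  [set v | [&& vieta_cubic h v == 0, (flip_defect h v != 0) == b1,
    (flip_defect h (rot3 v) != 0) == b2
    & (flip_defect h (rot3 (rot3 v)) != 0) == b3]].

Arguments flip_defect {F} h v : simpl never.
Arguments vieta_cubic {F} h v : simpl never.

Section Degrees.
Context {F : finFieldType} (h : F).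
Local Notation C := (2%:R * h).
Local Notation D := (4%:R - 4%:R * h - h ^+ 2).
Local Notation defect := (flip_defect h).
Local Notation class := (flip_class h).

Lemma vertexE v : (v \in vieta_vertices C D) = (vieta_cubic h v == 0).
Proof.
case: v => [[x y] z]; rewrite inE -subr_eq0 /vieta_cubic; congr (_ == 0); ring.
Qed.

Lemma rot3K : cancel (fun v : F * F * F => rot3 (rot3 v)) rot3.
Proof. by case=> [[x y] z]. Qed.

Lemma rot3_inj : injective (@rot3 F).
Proof. by move=> [[x y] z] [[x' y'] z'] [-> -> ->]. Qed.

Lemma vieta_cubic_rot3 v : vieta_cubic h (rot3 v) = vieta_cubic h v.
Proof. case: v => [[x y] z]; rewrite /vieta_cubic /rot3; ring. Qed.

Lemma card_flip_class_rot b1 b2 b3 : #|class b1 b2 b3| = #|class b2 b3 b1|.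
Proof.
rewrite -(card_imset _ rot3_inj); apply: eq_card => v.
rewrite -[v]rot3K mem_imset; last exact: rot3_inj.
rewrite !inE rot3K !vieta_cubic_rot3.
by case: v => [[x y] z]; rewrite /rot3 [X in _ && X = _]andbC -andbA.
Qed.

(** Used for the degrees 1 and 2: which flip is the exceptional one gives three patterns,
    equinumerous by rotation. *)
Lemma sum_card_flip_class b1 b2 b3 :
  (#|class b1 b2 b3| + #|class b2 b3 b1| + #|class b3 b1 b2| = 3 * #|class b1 b2 b3|)%N.
Proof.
by rewrite (card_flip_class_rot b3) (card_flip_class_rot b1) !mulSn mul0n addn0 addnA.
Qed.

(** Flips that move [v] change different coordinates, so they lead to distinct neighbours. *)
Lemma vieta_degreeE v : v \in vieta_vertices C D ->
  vieta_degree C D v = ((defect v != 0%R) + (defect (rot3 v) != 0%R)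
                         + (defect (rot3 (rot3 v)) != 0%R))%N.
Proof.
case: v => [[x y] z] vV.
pose dx := - defect (x, y, z); pose dy := - defect (y, z, x); pose dz := - defect (z, x, y).
have nbhE w : vieta_edge C D (x, y, z) w =
    (w != (x, y, z)) && (w \in [:: (x + dx, y, z); (x, y + dy, z); (x, y, z + dz)]).
  rewrite /vieta_edge vV andTb.
  have -> : vieta_flips C (x, y, z) = [:: (x + dx, y, z); (x, y + dy, z); (x, y, z + dz)].
    rewrite /vieta_flips /dx /dy /dz /flip_defect; congr [:: (_, _, _); (_, _, _); (_, _, _)]; ring.
  (* A flip exchanges the two roots of the cubic in one variable, so it preserves the surface. *)
  have flipV : w \in [:: (x + dx, y, z); (x, y + dy, z); (x, y, z + dz)] ->
      w \in vieta_vertices C D.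
    move: vV; rewrite !vertexE !inE => /eqP vV /or3P[]/eqP->; apply/eqP; rewrite -[RHS]vV;
    by rewrite /vieta_cubic /dx /dy /dz /flip_defect; ring.
  (* Flips are involutions, so the reversed clause of the edge relation adds no neighbour. *)
  have symV : (x, y, z) \in vieta_flips C w ->
      w \in [:: (x + dx, y, z); (x, y + dy, z); (x, y, z + dz)].
    case: w {flipV} => [[a b] c]; rewrite !inE /dx /dy /dz /flip_defect.
    case/or3P=> /eqP[-> -> ->]; apply/or3P;
      [constructor 1|constructor 2|constructor 3];
      apply/eqP; congr (_, _, _); ring.
  rewrite [_ == w]eq_sym; case: eqP => _; rewrite ?andbF //=.
  apply/andP/idP=> [[_ /orP[//|/symV//]]|wn]; split; [exact: flipV|by rewrite wn].
rewrite /vieta_degree /rot3 -[defect (x, y, z) == 0]oppr_eq0.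
rewrite -[defect (y, z, x) == 0]oppr_eq0 -[defect (z, x, y) == 0]oppr_eq0.
rewrite -/dx -/dy -/dz.
pose nb := [seq w <- [:: (x + dx, y, z); (x, y + dy, z); (x, y, z + dz)] | w != (x, y, z)].
have add_eq (a d : F) : (a + d == a) = (d == 0) by rewrite -[RHS](inj_eq (addrI a)) addr0.
transitivity (size nb).
  rewrite -(card_uniqP _); first by apply: eq_card => w; rewrite inE nbhE mem_filter.
  rewrite /nb /= !xpair_eqE !add_eq !eqxx /= !andbT.
  by have [d1|d1] := eqVneq dx 0; have [d2|d2] := eqVneq dy 0; have [d3|d3] := eqVneq dz 0;
    rewrite //= !inE !xpair_eqE !(add_eq, eq_sym _ (_ + _)) ?(negPf d1) ?(negPf d2) ?(negPf d3) /=
      ?andbF.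
by rewrite /nb /= !xpair_eqE !add_eq !eqxx /= !andbT; do 3!case: (_ == 0).
Qed.

Let mem_flip_classE v b1 b2 b3 : (v \in class b1 b2 b3) =
  [&& v \in vieta_vertices C D, (defect v != 0) == b1,
    (defect (rot3 v) != 0) == b2 & (defect (rot3 (rot3 v)) != 0) == b3].
Proof. by rewrite vertexE inE. Qed.

Lemma card_of_degree0 : #|vieta_of_degree C D 0| = #|class false false false|.
Proof.
apply: eq_card => v; rewrite mem_flip_classE inE.
case: (boolP (v \in _)) => //= vV; rewrite vieta_degreeE //.
by do 3!case: (defect _ != 0).
Qed.

Lemma card_of_degree1 : #|vieta_of_degree C D 1| = (3 * #|class true false false|)%N.
Proof.
rewrite -sum_card_flip_class.
rewrite -!sum1_card !(big_mkcond (fun v => v \in _)) -!big_split; apply: eq_bigr => v _ /=.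
rewrite !mem_flip_classE inE.
case: (boolP (v \in _)) => //= vV; rewrite vieta_degreeE //.
by do 3!case: (defect _ != 0).
Qed.

Lemma card_of_degree2 : #|vieta_of_degree C D 2| = (3 * #|class false true true|)%N.
Proof.
rewrite -sum_card_flip_class.
rewrite -!sum1_card !(big_mkcond (fun v => v \in _)) -!big_split; apply: eq_bigr => v _ /=.
rewrite !mem_flip_classE inE.
case: (boolP (v \in _)) => //= vV; rewrite vieta_degreeE //.
by do 3!case: (defect _ != 0).
Qed.

End Degrees.

Lemma card_deficient {F : finFieldType} (C D : F) : #|vieta_deficient C D| =
  (#|vieta_of_degree C D 0| + #|vieta_of_degree C D 1| + #|vieta_of_degree C D 2|)%N.
Proof.
rewrite /vieta_deficient /vieta_of_degree; move: (vieta_vertices C D) => V.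
rewrite -!sum1_card !(big_mkcond (fun v => v \in _)) -!big_split; apply: eq_bigr => v _ /=.
by rewrite !inE; case: (boolP (v \in V)) => //= _; case: vieta_degree => [|[|[]]].
Qed.

(** * The lines and hyperbolas of fixed vertices *)

Section Classes.
Context {F : finFieldType} (h : F).
Hypothesis two_neq0 : (2%:R : F) != 0.
Local Notation defect := (flip_defect h).
Local Notation class := (flip_class h).

Lemma four_neq0 : (4%:R : F) != 0.
Proof. by rewrite (natrM F 2 2) mulf_neq0. Qed.

Lemma two_neq_opp : (2%:R == - 2%:R :> F) = false.
Proof.
apply/negP=> /eqP e; case/negP: four_neq0; apply/eqP.
by transitivity (2%:R - - 2%:R : F); [ring|rewrite -e subrr].
Qed.

(* The discriminant of the cubic in its first variable factors. *)
Lemma fixed_vertexE x y z : defect (x, y, z) = 0 ->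
  (vieta_cubic h (x, y, z) == 0) =
  [|| y == - 2%:R, z == - 2%:R | (y - 2%:R) * (z - 2%:R) == 4%:R * h].
Proof.
move=> fx.
have disc : - (4%:R * vieta_cubic h (x, y, z)) =
    (y + 2%:R) * ((z + 2%:R) * ((y - 2%:R) * (z - 2%:R) - 4%:R * h)).
  transitivity (defect (x, y, z) ^+ 2 - 4%:R * vieta_cubic h (x, y, z)).
    by rewrite fx expr0n sub0r.
  by rewrite /vieta_cubic /flip_defect; ring.
rewrite -[LHS]orFb -(negPf four_neq0) -mulf_eq0 -oppr_eq0 disc !mulf_eq0.
by rewrite subr_eq0 !addr_eq0.
Qed.

(** The two defects differ by [(x - y) * (z + 2)]. *)
Lemma fixed12 x y z : defect (x, y, z) = 0 -> defect (y, z, x) = 0 ->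
  x = y \/ z = - 2%:R.
Proof.
move=> fx fy; have /eqP : (x - y) * (z + 2%:R) = 0.
  transitivity (defect (x, y, z) - defect (y, z, x)); last by rewrite fx fy subrr.
  by rewrite /flip_defect; ring.
by rewrite mulf_eq0 subr_eq0 addr_eq0 => /orP[] /eqP; [left|right].
Qed.

(** At [z = -2] the defect is [2 (x + y + h)]. It is symmetric in [x] and [y], which is why one line
    is fixed by two flips. *)
Lemma fixed12_line x y : defect (x, y, - 2%:R) = 0 -> y = - h - x.
Proof.
move=> fx; apply: (mulfI two_neq0); apply/eqP; rewrite -subr_eq0 -fx.
by apply/eqP; rewrite /flip_defect; ring.
Qed.

(** This is where the hyperbola meets the locus of two equal coordinates fixed by their flips.
    Subtracting the hypotheses gives [2 (b - 2) = -2 h], and the first then becomes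
    [h (a + 2) = 0]. *)
Lemma fixed_diagonal a b : a * (b - 2%:R) = 2%:R * h ->
  (a - 2%:R) * (b - 2%:R) = 4%:R * h -> b - 2%:R = - h /\ (h = 0 \/ a = - 2%:R).
Proof.
move=> ab1 ab2; have bh : b - 2%:R = - h.
  apply: (mulfI two_neq0); transitivity (a * (b - 2%:R) - (a - 2%:R) * (b - 2%:R)).
    by ring.
  by rewrite ab1 ab2; ring.
split=> //; have /eqP : h * (a + 2%:R) = 0.
  by rewrite -[RHS](subrr (2%:R * h)) -{2}ab1 bh; ring.
by rewrite mulf_eq0 addr_eq0 => /orP[] /eqP; [left|right].
Qed.

(** * Vertices moved by the first flip only *)

(** On the line [y + z = -h] the first defect is [(y + 2) (y + h - 2)]; its zeros are the points
    fixed by all flips. *)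
Lemma class100_line x y z : x = - 2%:R ->
  ((x, y, z) \in class true false false) =
  [&& z == - h - y, y != - 2%:R & y != 2%:R - h].
Proof.
move=> ->; rewrite inE /rot3.
have [->|zE] /= := eqVneq z (- h - y); last first.
  apply/negP=> /and4P[_ _]; rewrite eqbF_neg negbK => /eqP fy _.
  by case/eqP: zE; apply: fixed12_line.
have fy : defect (y, - h - y, - 2%:R) = 0 by rewrite /flip_defect; ring.
have fz : defect (- h - y, - 2%:R, y) = 0 by rewrite /flip_defect; ring.
have -> : vieta_cubic h (- 2%:R, y, - h - y) = 0 by rewrite /vieta_cubic; ring.
have -> : defect (- 2%:R, y, - h - y) = (y - - 2%:R) * (y - (2%:R - h)).
  by rewrite /flip_defect; ring.
by rewrite fy fz eqxx !andbT mulf_eq0 !subr_eq0 negb_or; do 2!case: (y == _).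
Qed.

Lemma class100_offline x y z : (x, y, z) \in class true false false ->
  x != - 2%:R -> y = z /\ z * (x - 2%:R) = 2%:R * h.
Proof.
rewrite inE /rot3 => /and4P[_ _]; rewrite !eqbF_neg !negbK => /eqP fy /eqP fz x2.
have [yz|xE] := fixed12 _ _ _ fy fz; last by rewrite xE eqxx in x2.
split=> //; rewrite yz in fz; apply/eqP; rewrite eq_sym -subr_eq0 -fz.
by apply/eqP; rewrite /flip_defect; ring.
Qed.

(** By [fixed_diagonal] a further line arises only when [h = 0] and the hyperbola degenerates. Its
    first defect [(2 - z) (z + 2)] accounts for the two removed points. *)
Lemma class100_offlineP x y z : x != - 2%:R ->
  ((x, y, z) \in class true false false) =
  [&& h == 0, x == 2%:R, y == z, z != - 2%:R & z != 2%:R].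
Proof.
move=> x2; apply/idP/and5P=> [xyz|[/eqP h0 /eqP-> /eqP-> z1 z2]]; last first.
  rewrite inE /rot3 /vieta_cubic /flip_defect h0.
  have -> : 2%:R * 2%:R - z * z + 2%:R * 0 = (2%:R - z) * (z - - 2%:R) by ring.
  rewrite mulf_eq0 !subr_eq0 (negPf z1) [2%:R == z]eq_sym (negPf z2).
  by rewrite !eqbF_neg !negbK; apply/and4P; split=> //; apply/eqP; ring.
have [yz zx] := class100_offline _ _ _ xyz x2.
move: xyz; rewrite yz inE /rot3 => /and4P[V].
rewrite eqb_id => /negP fx _; rewrite eqbF_neg negbK => /eqP fz.
(* Two rotations bring the third coordinate, fixed by its flip, to the front, as [fixed_vertexE]
   requires. *)
move: V fx; rewrite -vieta_cubic_rot3 -vieta_cubic_rot3 /rot3 fixed_vertexE //.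
rewrite (negPf x2) /= => V fx.
have z2 : z != - 2%:R.
  apply/negP=> /eqP zE; case: fx; rewrite zE in zx *; apply/eqP.
  by transitivity (2%:R * h - - 2%:R * (x - 2%:R)); [rewrite /flip_defect; ring|rewrite zx subrr].
move: V; rewrite (negPf z2) /= => /eqP V.
have [xh []] := fixed_diagonal _ _ zx (etrans (mulrC _ _) V); last first.
  by move=> zE; rewrite zE eqxx in z2.
move=> h0.
have xE : x = 2%:R by apply/eqP; rewrite -subr_eq0 xh h0 oppr0.
split=> //; [exact/eqP|exact/eqP|].
by apply/negP=> /eqP zE; case: fx; rewrite xE zE h0 /flip_defect; apply/eqP; ring.
Qed.

(** The successor counts the punctures [-2] and [2 - h] of the line, which merge iff [h = 4]. *)
Lemma card_class100_generic : h != 0 ->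
  (#|class true false false| + (4%:R != h).+1 = #|F|)%N.
Proof.
move=> h0; rewrite -[#|F|](cardsC [set - 2%:R; 2%:R - h]) cards2 addnC; congr (_.+1 + _)%N.
  congr nat_of_bool; congr negb; rewrite -[RHS]subr_eq0 -[LHS]subr_eq0 -oppr_eq0.
  by congr (_ == 0); ring.
have inj : injective (fun t => (- 2%:R : F, t, - h - t)) by move=> t1 t2 [].
rewrite -(card_imset _ inj); apply: eq_card => -[[x y] z].
have [xE|x2] := eqVneq x (- 2%:R).
  rewrite class100_line //; apply/and3P/imsetP=> [[/eqP-> y1 y2]|[t]].
    by exists y; rewrite ?xE // !inE negb_or y1.
  by rewrite !inE negb_or => /andP[t1 t2] [_ -> ->]; rewrite eqxx.
rewrite class100_offlineP // (negPf h0); apply/esym/imsetP=> -[t _ [xE]].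
by rewrite xE eqxx in x2.
Qed.

(** Two disjoint lines, [x = -2] and [x = 2], each lose the two parameters [-2] and [2]. *)
Lemma card_class100_zero : h = 0 -> (#|class true false false| + 4 = 2 * #|F|)%N.
Proof.
move=> h0; pose T := ~: [set - 2%:R; 2%:R : F].
have cT : (#|T| + 2 = #|F|)%N.
  by rewrite addnC -(cardsC [set - 2%:R; 2%:R : F]) cards2 eq_sym two_neq_opp.
pose f (bt : bool * F) := (if bt.1 then 2%:R else - 2%:R : F, bt.2, if bt.1 then bt.2 else - bt.2).
have inj : injective f.
  move=> [b t] [b' t'] [/eqP + <- _].
  by case: b b' => [] [] //=; rewrite ?two_neq_opp // eq_sym two_neq_opp.
transitivity (#|f @: setX [set: bool] T| + 4)%N.
  congr (_ + 4)%N; apply: eq_card => -[[x y] z].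
  apply/idP/imsetP=> [|[[b t]]]; last first.
    rewrite in_setX in_setT in_setC in_set2 negb_or /= => /andP[t1 t2] [-> -> ->].
    case: b => /=; first by rewrite class100_offlineP ?two_neq_opp // h0 !eqxx t1.
    by rewrite class100_line // h0 subr0 oppr0 add0r eqxx t1.
  have [xE|x2] := eqVneq x (- 2%:R).
    rewrite class100_line // h0 subr0 oppr0 add0r => /and3P[/eqP zE y1 y2].
    by exists (false, y); rewrite ?inE /f /= ?negb_or ?y1 // xE zE.
  rewrite class100_offlineP // => /and5P[_ /eqP-> /eqP-> z1 z2].
  by exists (true, z); rewrite ?inE /f /= ?negb_or ?z1.
by rewrite card_imset // cardsX cardsT card_bool -cT mulnDr.
Qed.

(** * Vertices fixed by the first flip only *)

(** If [y = -2] or [z = -2], another defect equals the first, so only the hyperbola remains. On it a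
    second vanishing defect would, by [fixed_diagonal], force [h = 0] or a coordinate [-2]. *)
Lemma class011P x y z : ((x, y, z) \in class false true true) =
  [&& defect (x, y, z) == 0, (y - 2%:R) * (z - 2%:R) == 4%:R * h,
      h != 0, y != - 2%:R & z != - 2%:R].
Proof.
apply/idP/and5P=> [|[/eqP fx /eqP yz h0 y2 z2]]; last first.
  rewrite inE /rot3 fixed_vertexE // fx yz !eqxx !orbT /= !eqb_id.
  apply/andP; split; apply/negP=> /eqP f.
    have [xy|zE] := fixed12 _ _ _ fx f; last by rewrite zE eqxx in z2.
    have yz1 : y * (z - 2%:R) = 2%:R * h.
      by apply/eqP; rewrite -subr_eq0 -oppr_eq0 -f xy; apply/eqP; rewrite /flip_defect; ring.
    have [_ [h1|y1]] := fixed_diagonal _ _ yz1 yz; first by rewrite h1 eqxx in h0.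
    by rewrite y1 eqxx in y2.
  have [zx|yE] := fixed12 _ _ _ f fx; last by rewrite yE eqxx in y2.
  have yz1 : z * (y - 2%:R) = 2%:R * h.
    by apply/eqP; rewrite -subr_eq0 -oppr_eq0 -f zx; apply/eqP; rewrite /flip_defect; ring.
  have [_ [h1|z1]] := fixed_diagonal _ _ yz1 (etrans (mulrC _ _) yz).
    by rewrite h1 eqxx in h0.
  by rewrite z1 eqxx in z2.
rewrite inE /rot3 => /and4P[V]; rewrite eqbF_neg negbK !eqb_id => /eqP fx fy fz.
have y2 : y != - 2%:R.
  apply: contra fz => /eqP yE; rewrite -fx yE; apply/eqP; rewrite /flip_defect; ring.
have z2 : z != - 2%:R.
  apply: contra fy => /eqP zE; rewrite -fx zE; apply/eqP; rewrite /flip_defect; ring.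
move: V; rewrite fixed_vertexE // (negPf y2) (negPf z2) /= => yz; split=> //; first exact/eqP.
apply/negP=> /eqP h0; move: yz; rewrite h0 mulr0 mulf_eq0 !subr_eq0 => /orP[]/eqP e.
  by move: fz; rewrite -oppr_eq0 -fx e h0 /flip_defect => /negP[]; apply/eqP; ring.
by move: fy; rewrite -oppr_eq0 -fx e h0 /flip_defect => /negP[]; apply/eqP; ring.
Qed.

(** The hyperbola is parametrized by [s = y - 2]. The excluded values [0], [-4], [-h] stand for no
    point, [y = -2] and [z = -2]; the last two agree iff [h = 4]. *)
Lemma card_class011_generic : h != 0 ->
  (#|class false true true| + (h != 4%:R) + 2 = #|F|)%N.
Proof.
move=> h0; pose T := ~: [set 0; - 4%:R; - h : F].
have cT : (#|T| + (h != 4%:R) + 2 = #|F|)%N.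
  rewrite -(cardsC T) setCK -addnA -setUA cardsU1 cards2 !inE eqr_opp; congr (_ + _)%N.
  rewrite ![0 == _]eq_sym !oppr_eq0 (negPf four_neq0) (negPf h0) [4%:R == h]eq_sym.
  by case: (h == _).
(* The hyperbola gives [z = 2 + 4 h / s]; combined with the vanishing defect it gives
   [x = y + z + h - 2]. *)
pose f (s : F) := (2%:R + s + 4%:R * h / s + h, 2%:R + s, 2%:R + 4%:R * h / s).
have inj : injective f by move=> s t [_ /addrI].
rewrite -cT -(card_imset _ inj); congr (_ + _ + _)%N; apply: eq_card => -[[x y] z].
rewrite class011P h0; apply/and5P/imsetP=> [[/eqP fx /eqP yz _ y2 z2]|[s]].
  have s0 : y - 2%:R != 0.
    apply/negP=> /eqP s0; move: yz; rewrite s0 mul0r => /esym/eqP.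
    by rewrite mulf_eq0 (negPf four_neq0) (negPf h0).
  have zE : z = 2%:R + 4%:R * h / (y - 2%:R) by rewrite -yz; field.
  exists (y - 2%:R).
    rewrite !inE !negb_or s0 /=; apply/andP; split.
      apply: contra y2 => /eqP e; apply/eqP; transitivity (y - 2%:R + 2%:R); first by ring.
      by rewrite e; ring.
    apply: contra z2 => /eqP e; apply/eqP; rewrite zE e; field; by rewrite oppr_eq0.
  have xE : x = y + z + h - 2%:R.
    apply: (mulfI two_neq0); apply/eqP; rewrite -subr_eq0 -fx; apply/eqP.
    transitivity (defect (x, y, z) + ((y - 2%:R) * (z - 2%:R) - 4%:R * h)).
      by rewrite /flip_defect; ring.
    by rewrite yz subrr addr0.
  rewrite /f -zE; congr (_, _, _); last by ring.
  by rewrite xE zE; ring.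
rewrite !inE !negb_or -andbA => /and3P[s0 s4 sh] [-> -> ->].
split=> //.
- by apply/eqP; rewrite /flip_defect; field.
- by apply/eqP; field.
- by apply: contra s4 => /eqP e; apply/eqP; rewrite -[s](addKr 2%:R) e; ring.
- apply: contra sh => /eqP e; apply/eqP.
  apply: (mulfI four_neq0); apply/eqP; rewrite -subr_eq0; apply/eqP.
  transitivity (s * (2%:R + 4%:R * h / s - - 2%:R)); first by field.
  by rewrite e subrr mulr0.
Qed.

Lemma card_class011_zero : h = 0 -> #|class false true true| = 0%N.
Proof.
move=> h0; apply: eq_card0 => -[[x y] z].
by rewrite class011P h0 eqxx /= !andbF.
Qed.

(** * Vertices fixed by all three flips *)

(** These are the pairwise intersections of the three lines; they collapse to one point when
    [h = 4]. *)
Definition nodes : {set F * F * F} :=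
  [set (- 2%:R, - 2%:R, 2%:R - h); (- 2%:R, 2%:R - h, - 2%:R); (2%:R - h, - 2%:R, - 2%:R)].

Lemma mem_nodes_rot3 v : (rot3 v \in nodes) = (v \in nodes).
Proof.
case: v => [[x y] z]; rewrite !inE /rot3 !xpair_eqE.
by case: (x == _); case: (x == _); case: (y == _); case: (y == _); case: (z == _); case: (z == _).
Qed.

Lemma mem_class000_rot3 v : (rot3 v \in class false false false) = (v \in class false false false).
Proof.
rewrite !inE vieta_cubic_rot3; congr (_ && _); case: v => [[x y] z].
by rewrite /rot3 [RHS]andbC -andbA.
Qed.

Lemma class000_line x y : (x, y, - 2%:R) \in class false false false ->
  (x, y, - 2%:R) \in nodes.
Proof.
rewrite inE /rot3 !eqbF_neg !negbK => /and4P[_ /eqP fx _ /eqP fz].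
have yE := fixed12_line _ _ fx.
have : (x - - 2%:R) * (x - (2%:R - h)) == 0.
  by rewrite -fz yE; apply/eqP; rewrite /flip_defect; ring.
rewrite mulf_eq0 !subr_eq0 !inE !xpair_eqE eqxx !andbT => /orP[]/eqP xE; rewrite yE xE.
  by rewrite (_ : _ - - _ = 2%:R - h) ?eqxx ?orbT //; ring.
by rewrite (_ : _ - (_ - _) = - 2%:R) ?eqxx ?orbT //; ring.
Qed.

(** Off the lines, [fixed12] applied twice makes all coordinates equal, and [fixed_diagonal] then
    leaves only [(2, 2, 2)] with [h = 0]. *)
Lemma class000P v : (v \in class false false false) =
  (v \in nodes) || (h == 0) && (v == (2%:R, 2%:R, 2%:R)).
Proof.
apply/idP/idP=> [|/orP[]]; last 2 first.
- rewrite !inE => /orP[/orP[]|]/eqP->; rewrite /rot3 /vieta_cubic /flip_defect !eqbF_neg !negbK;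
    by apply/and4P; split; apply/eqP; ring.
- case/andP=> /eqP h0 /eqP->; rewrite inE /rot3 /vieta_cubic /flip_defect !eqbF_neg !negbK h0.
  by apply/and4P; split; apply/eqP; ring.
case: v => [[x y] z] xyz.
have [zE|z2] := eqVneq z (- 2%:R).
  by rewrite zE in xyz *; rewrite class000_line.
have [xE|x2] := eqVneq x (- 2%:R).
  rewrite -mem_nodes_rot3 -mem_class000_rot3 xE in xyz *.
  by rewrite class000_line.
move: xyz; rewrite inE /rot3 !eqbF_neg !negbK => /and4P[V /eqP fx /eqP fy /eqP fz].
have [xy|zE] := fixed12 _ _ _ fx fy; last by rewrite zE eqxx in z2.
have [yz|xE] := fixed12 _ _ _ fy fz; last by rewrite xE eqxx in x2.
move: V fx; rewrite xy yz => V fx; move: V; rewrite fixed_vertexE // (negPf z2) /= => /eqP V.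
have V1 : z * (z - 2%:R) = 2%:R * h.
  by apply/eqP; rewrite -subr_eq0 -oppr_eq0 -fx; apply/eqP; rewrite /flip_defect; ring.
have [zh [h0|zE]] := fixed_diagonal _ _ V1 V; last by rewrite zE eqxx in z2.
have zE : z = 2%:R by apply/eqP; rewrite -subr_eq0 zh h0 oppr0.
by rewrite zE h0 !eqxx orbT.
Qed.

Lemma card_nodes : #|nodes| = if h == 4%:R then 1%N else 3%N.
Proof.
have [h4|h4] := eqVneq h 4%:R.
  have e : 2%:R - 4%:R = - 2%:R :> F by ring.
  by rewrite /nodes h4 e !setUid cards1.
have c2 : (2%:R - h == - 2%:R) = false.
  apply: contra_neqF h4 => /eqP e; apply/eqP; rewrite -subr_eq0 -oppr_eq0 opprB; apply/eqP.
  transitivity (2%:R - h - - 2%:R); [by ring|by rewrite e subrr].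
by rewrite /nodes -setUA cardsU1 cards2 !inE !xpair_eqE eqxx [- _ == _ - h]eq_sym c2 /= ?andbF.
Qed.

Lemma card_class000_generic : h != 0 ->
  #|class false false false| = if h == 4%:R then 1%N else 3%N.
Proof.
move=> h0; rewrite -card_nodes; apply: eq_card => v.
by rewrite class000P (negPf h0) orbF.
Qed.

Lemma card_class000_zero : h = 0 -> #|class false false false| = 4%N.
Proof.
move=> h0.
transitivity #|(2%:R, 2%:R, 2%:R) |: nodes|.
  by apply: eq_card => v; rewrite class000P h0 eqxx in_setU1 orbC.
rewrite cardsU1 card_nodes h0 [0 == _]eq_sym (negPf four_neq0).
by rewrite !inE !xpair_eqE two_neq_opp /= !andbF.
Qed.

End Classes.

(** * Specialization to ['F_p] *)

Theorem theorem11p2 (p : nat) (p_prime : prime p) (p_ge5 : (5 <= p)%N)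
    (C D : 'F_p) (D_def : D = 4%:R - 2%:R * C - C ^+ 2 / 4%:R) :
  [/\ C = 0 ->
        [/\ #|vieta_vertices C D| = (p ^ 2 + 1)%N,
            #|vieta_deficient C D| = (6 * p - 8)%N,
            #|vieta_of_degree C D 2| = 0%N,
            #|vieta_of_degree C D 1| = (6 * (p - 2))%N
          & #|vieta_of_degree C D 0| = 4%N],
      C = 8%:R ->
        [/\ #|vieta_vertices C D| = (p ^ 2 + 1)%N,
            #|vieta_deficient C D| = (6 * p - 8)%N,
            #|vieta_of_degree C D 2| = (3 * (p - 2))%N,
            #|vieta_of_degree C D 1| = (3 * (p - 1))%N
          & #|vieta_of_degree C D 0| = 1%N]
    & C <> 0 -> C <> 8%:R ->
        [/\ #|vieta_vertices C D| = (p ^ 2 + 1 + p)%N \/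
            #|vieta_vertices C D| = (p ^ 2 + 1 - p)%N,
            #|vieta_deficient C D| = (6 * p - 12)%N,
            #|vieta_of_degree C D 2| = (3 * (p - 3))%N,
            #|vieta_of_degree C D 1| = (3 * (p - 2))%N
          & #|vieta_of_degree C D 0| = 3%N]].
Proof.
have dvdE n : ((n%:R : 'F_p) == 0) = (p %| n)%N by rewrite -(dvdn_pcharf (pchar_Fp p_prime)).
have two_neq0 : (2%:R : 'F_p) != 0 by rewrite dvdE gtnNdvd // (leq_trans _ p_ge5).
have four_neq0 := four_neq0 two_neq0.
have cardF : #|'F_p| = p by rewrite card_Fp.
pose h := C / 2%:R.
have CE : C = 2%:R * h by rewrite /h mulrC divfK.
have DE : D = 4%:R - 4%:R * h - h ^+ 2 by rewrite D_def CE; field.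
have C0 : (C == 0) = (h == 0) by rewrite CE mulf_eq0 (negPf two_neq0).
have C8 : (C == 8%:R) = (h == 4%:R).
  by rewrite CE (natrM _ 2 4) (inj_eq (mulfI two_neq0)).
have := card_vertices two_neq0 h.
have := card_of_degree0 h; have := card_of_degree1 h; have := card_of_degree2 h.
have := card_deficient C D.
rewrite -CE -DE cardF => -> -> -> -> cardV; split.
- move/eqP; rewrite C0 => /eqP h0.
  move: cardV; rewrite h0 mul0r quad_char0 mulr0 addr0 => -[->].
  have := card_class100_zero h two_neq0 h0; rewrite cardF.
  rewrite -h0 (card_class011_zero h two_neq0) // (card_class000_zero h two_neq0) //.
  by move=> e; split; lia.
- move/eqP; rewrite C8 => /eqP h4; have h0 : h != 0 by rewrite h4.
  move: cardV; rewrite h4 subrr mulr0 quad_char0 mulr0 addr0 => -[->].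
  have := card_class100_generic h two_neq0 h0; have := card_class011_generic h two_neq0 h0.
  have := card_class000_generic h two_neq0 h0; rewrite cardF h4 !eqxx /=.
  by move=> -> e1 e2; split; lia.
move=> /eqP; rewrite C0 => h0 /eqP; rewrite C8 => h4.
have := card_class100_generic h two_neq0 h0; have := card_class011_generic h two_neq0 h0.
have := card_class000_generic h two_neq0 h0.
rewrite cardF [4%:R == h]eq_sym h4 (negPf h4) /= => -> e1 e2.
split; [|lia..].
(* A nonzero argument makes the character 1 or -1, the source of the two possible totals. *)
have hh : h * (h - 4%:R) != 0 by rewrite mulf_neq0 // subr_eq0.
(* Needed because the total with the minus sign uses truncated subtraction on naturals. *)
have p2 : (p <= p ^ 2)%N by rewrite -[leqLHS]expn1 leq_exp2l //; lia.
move: cardV; have [[w wE ->]|[_ ->]] := quad_charP two_neq0 (h * (h - 4%:R)).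
  have -> : w != 0 by apply: contraNneq hh => w0; rewrite wE w0 expr0n.
  by rewrite mulr1 -PoszD => -[->]; left.
by rewrite mulrN1 subzn ?(leq_trans p2) ?leq_addr // => -[->]; right.
Qed.
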